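(* Consider the following four sets of morphisms of $\epsilon$-simplicial sets: (i) $I_1=\epsilon\text{-}\mathrm{Horn}\cup\{\partial_1\Delta_\epsilon^4\cup\partial_3\Delta_\epsilon^4\hookrightarrow\Delta_\epsilon^4\}$, (ii) $I_2=\epsilon\text{-}\mathrm{Horn}\cup\{\partial_2\Delta_\epsilon^4\cup\Delta^{\{1,2,3\}}\hookrightarrow\Delta_\epsilon^4\}$, (iii) $I_3=\epsilon\text{-}\mathrm{Horn}\cup\{\partial_1\Delta^3\cup\partial_3\Delta^3\hookrightarrow\Delta^3\}$, (iv) $I_4=\epsilon\text{-}\mathrm{Horn}\cup\{\partial_0\Delta^3\cup\partial_2\Delta^3\hookrightarrow\Delta^3\}$. Then $\overline{I_1}\cup\overline{I_2}\subseteq\overline{I_3}\cap\overline{I_4}$.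
   Context: $\Delta$ is the category of finite chains $[n]=\{0<\dots<n\}$ and non-decreasing maps. $\Delta_\epsilon$ is the category obtained from $\Delta$ by freely adding one object $[\epsilon]$, one arrow $w\colon[1]\to[\epsilon]$, and the induced compositions. An $\epsilon$-simplicial set is a presheaf of sets on $\Delta_\epsilon$; equivalently, a simplicial set $X$ together with a set $X_\epsilon$ and a map $X_\epsilon\to X_1$ (edges in its image are ''marked''). A simplicial set is regarded as an $\epsilon$-simplicial set with $X_\epsilon=\emptyset$. $\Delta^n$ is the standard simplex, $\partial_i\Delta^n$ its codimension-one face opposite the vertex $i$, and $\Delta^S$, $S\subseteq\{0,\dots,n\}$, its face spanned by the vertices in $S$ (no marked edges). For $n\ge1$, $\Delta_\epsilon^n$ is the $\epsilon$-simplicial set with underlying simplicial set $\Delta^n$ and $(\Delta_\epsilon^n)_\epsilon$ a one-element set mapped to the edge from $0$ to $n$. $\partial_i\Delta_\epsilon^n\subset\Delta_\epsilon^n$ is the face opposite the vertex $i$, where the marked edge remains marked if it belongs to the face. $\Lambda^n_{\epsilon,i}=\bigcup_{j\neq i}\partial_j\Delta_\epsilon^n$. $\epsilon\text{-}\mathrm{Horn}$ denotes the set of inclusions $\Lambda^n_{\epsilon,0}\subset\Delta_\epsilon^n$ and $\Lambda^n_{\epsilon,n}\subset\Delta_\epsilon^n$, $n\ge1$. For a set $\mathcal{I}$ of morphisms of $\epsilon$-simplicial sets, $\overline{\mathcal{I}}$ is the class of morphisms having the left lifting property with respect to all morphisms that have the right lifting property with respect to every element of $\mathcal{I}$; it is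 the least weakly saturated class (closed under compositions, transfinite compositions, pushouts and retracts) containing $\mathcal{I}$. *)

(* Defs.v *)
From HB Require Import structures.
From mathcomp Require Import all_boot.

Set Implicit Arguments.
Unset Strict Implicit.
Unset Printing Implicit Defensive.

(* [dmap m n] is the set of non-decreasing maps [m] -> [n], the chain [n]
   being 'I_n.+1; using finite functions makes equality of maps extensional. *)
Record dmap (m n : nat) := DMap {
  dmap_fun :> {ffun 'I_m.+1 -> 'I_n.+1};
  _ : [forall i : 'I_m.+1, forall j : 'I_m.+1,
        (i <= j) ==> (dmap_fun i <= dmap_fun j)] }.

HB.instance Definition _ m n := [isSub for @dmap_fun m n].
HB.instance Definition _ m n := [Finite of dmap m n by <:].

Lemma dmap_homo m n (f : dmap m n) (i j : 'I_m.+1) : i <= j -> f i <= f j.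
Proof. by case: f => f /= /forallP/(_ i)/forallP/(_ j)/implyP; apply. Qed.

Lemma did_subproof n :
  [forall i : 'I_n.+1, forall j : 'I_n.+1,
    (i <= j) ==> ([ffun k : 'I_n.+1 => k] i <= [ffun k : 'I_n.+1 => k] j)].
Proof.
by apply/forallP=> i; apply/forallP=> j; apply/implyP; rewrite !ffunE.
Qed.

Definition did n : dmap n n := DMap (did_subproof n).

Lemma dcomp_subproof l m n (f : dmap m n) (g : dmap l m) :
  [forall i : 'I_l.+1, forall j : 'I_l.+1, (i <= j) ==>
    ([ffun k : 'I_l.+1 => f (g k)] i <= [ffun k : 'I_l.+1 => f (g k)] j)].
Proof.
apply/forallP=> i; apply/forallP=> j; apply/implyP=> le_ij.
by rewrite !ffunE !dmap_homo.
Qed.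

Definition dcomp l m n (f : dmap m n) (g : dmap l m) : dmap l n :=
  DMap (dcomp_subproof f g).

Lemma dcompA k l m n (f : dmap m n) (g : dmap l m) (h : dmap k l) :
  dcomp f (dcomp g h) = dcomp (dcomp f g) h.
Proof. by apply/val_inj/ffunP=> i; rewrite /= !ffunE. Qed.

Lemma dcomp1d m n (f : dmap m n) : dcomp (did n) f = f.
Proof. by apply/val_inj/ffunP=> i; rewrite /= !ffunE. Qed.

Lemma dcompd1 m n (f : dmap m n) : dcomp f (did m) = f.
Proof. by apply/val_inj/ffunP=> i; rewrite /= !ffunE. Qed.

Record sset := SSet {
  simplex :> nat -> Type;
  act : forall m n, dmap m n -> simplex n -> simplex m;
  act_id : forall n (x : simplex n), act (did n) x = x;
  act_comp : forall l m n (f : dmap m n) (g : dmap l m) (x : simplex n),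
    act (dcomp f g) x = act g (act f x) }.

(* A presheaf on Delta_epsilon: the only generating arrow outside Delta is
   w : [1] -> [epsilon], subject to no relation, so it contributes exactly
   the map [edge]. Nothing forces [edge] to be injective. *)
Record esset := ESSet {
  usset :> sset;
  marked : Type;
  edge : marked -> usset 1 }.

Definition flat (X : sset) : esset :=
  @ESSet X void (fun e => match e with end).

Record shom (X Y : sset) := SHom {
  shom_fun :> forall n, X n -> Y n;
  shom_act : forall m n (f : dmap m n) (x : X n),
    shom_fun (act f x) = act f (shom_fun x) }.

Record ehom (X Y : esset) := EHom {
  ehom_s :> shom X Y;
  ehom_m : marked X -> marked Y;
  ehom_edge : forall e : marked X, ehom_s 1 (edge e) = edge (ehom_m e) }.

(* Equality of natural transformations is componentwise. *)
Definition ehom_eq (X Y : esset) (f g : ehom X Y) : Prop :=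
  (forall n (x : X n), f n x = g n x) /\
  (forall e : marked X, ehom_m f e = ehom_m g e).

Lemma scomp_subproof (X Y Z : sset) (g : shom Y Z) (f : shom X Y) m n
    (a : dmap m n) (x : X n) :
  g m (f m (act a x)) = act a (g n (f n x)).
Proof. by rewrite !shom_act. Qed.

Definition scomp (X Y Z : sset) (g : shom Y Z) (f : shom X Y) : shom X Z :=
  SHom (scomp_subproof g f).

Lemma ecomp_subproof (X Y Z : esset) (g : ehom Y Z) (f : ehom X Y)
    (e : marked X) :
  scomp g f 1 (edge e) = edge (ehom_m g (ehom_m f e)).
Proof. by rewrite /= !ehom_edge. Qed.

Definition ecomp (X Y Z : esset) (g : ehom Y Z) (f : ehom X Y) : ehom X Z :=
  EHom (ecomp_subproof g f).

(* Membership is boolean: all the subobjects below are decidable, and the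
   simplices of a subobject then form a subtype with an injective [val]. *)
Record ssub (X : sset) := SSub {
  smem : forall n, pred (X n);
  smem_act : forall m n (f : dmap m n) (x : X n),
    smem x -> smem (act f x) }.

Record esub (X : esset) := ESub {
  esub_s :> ssub X;
  mmem : pred (marked X);
  mmem_edge : forall e : marked X, mmem e -> smem esub_s (edge e) }.

Section SubObject.
Variables (X : esset) (A : esub X).

Definition sub_simplex n : Type := {x : X n | smem A x}.

Definition sub_act m n (f : dmap m n) (x : sub_simplex n) : sub_simplex m :=
  exist _ (act f (val x)) (smem_act f (valP x)).

Lemma sub_act_id n (x : sub_simplex n) : sub_act (did n) x = x.
Proof. by apply: val_inj; rewrite /= act_id. Qed.

Lemma sub_act_comp l m n (f : dmap m n) (g : dmap l m) (x : sub_simplex n) :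
  sub_act (dcomp f g) x = sub_act g (sub_act f x).
Proof. by apply: val_inj; rewrite /= act_comp. Qed.

Definition sub_edge (e : {e : marked X | mmem A e}) : sub_simplex 1 :=
  exist _ (edge (val e)) (mmem_edge (valP e)).

Definition esset_of_sub : esset :=
  @ESSet (SSet sub_act_id sub_act_comp) {e : marked X | mmem A e} sub_edge.

Definition incl_s : shom esset_of_sub X :=
  @SHom esset_of_sub X (fun n x => val x) (fun m n f x => erefl).

Definition incl : ehom esset_of_sub X :=
  @EHom esset_of_sub X incl_s (fun e => val e) (fun e => erefl).

End SubObject.

(* The subobject on a given simplicial subset in which the marked edges that
   belong to it remain marked. *)
Definition induced (X : esset) (A : ssub X) : esub X :=
  @ESub X A (fun e => smem A (edge e)) (fun e eA => eA).

(* The subobject on a given simplicial subset without marked edges. *)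
Definition unmarked (X : esset) (A : ssub X) : esub X :=
  @ESub X A pred0 (fun e (eA : pred0 e) =>
    match notF eA with end).

Section Unions.
Variable X : esset.

Lemma subU_act (A B : esub X) m n (f : dmap m n) (x : X n) :
  smem A x || smem B x -> smem A (act f x) || smem B (act f x).
Proof. by case/orP=> /(smem_act f)->; rewrite ?orbT. Qed.

Lemma subU_edge (A B : esub X) (e : marked X) :
  mmem A e || mmem B e -> smem A (edge e) || smem B (edge e).
Proof. by case/orP=> /mmem_edge->; rewrite ?orbT. Qed.

Definition subU (A B : esub X) : esub X :=
  @ESub X (@SSub X (fun n x => smem A x || smem B x) (@subU_act A B))
    (fun e => mmem A e || mmem B e) (@subU_edge A B).

Variables (I : finType) (P : pred I) (A : I -> esub X).

Lemma bigsubU_act m n (f : dmap m n) (x : X n) :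
  [exists (j | P j), smem (A j) x] -> [exists (j | P j), smem (A j) (act f x)].
Proof.
case/existsP=> j /andP[Pj /(smem_act f) Ajx].
by apply/existsP; exists j; rewrite Pj.
Qed.

Lemma bigsubU_edge (e : marked X) :
  [exists (j | P j), mmem (A j) e] -> [exists (j | P j), smem (A j) (edge e)].
Proof.
case/existsP=> j /andP[Pj /mmem_edge Aje].
by apply/existsP; exists j; rewrite Pj.
Qed.

Definition bigsubU : esub X :=
  @ESub X
    (@SSub X (fun n x => [exists (j | P j), smem (A j) x]) bigsubU_act)
    (fun e => [exists (j | P j), mmem (A j) e]) bigsubU_edge.

End Unions.

Definition Delta (n : nat) : sset :=
  @SSet (fun m => dmap m n) (fun l m g f => dcomp f g)
    (fun m f => dcompd1 f) (fun k l m g h f => dcompA f g h).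

Lemma long_edge_subproof n :
  [forall i : 'I_2, forall j : 'I_2, (i <= j) ==>
    ([ffun k : 'I_2 => if k == ord0 then ord0 else @ord_max n] i
     <= [ffun k : 'I_2 => if k == ord0 then ord0 else @ord_max n] j)].
Proof.
apply/forallP=> i; apply/forallP=> j; apply/implyP; rewrite !ffunE.
have [// | i_n0] := eqVneq i ord0; have [-> | _ _] := eqVneq j ord0.
  by rewrite leqn0 => i0; case/eqP: i_n0; apply/val_inj/eqP.
by [].
Qed.

(* The edge of Delta^n from 0 to n. *)
Definition long_edge (n : nat) : Delta n 1 := DMap (long_edge_subproof n).

(* This is Delta_epsilon^n for n >= 1; it is only used for such n. *)
Definition Delta_e (n : nat) : esset :=
  @ESSet (Delta n) unit (fun _ => long_edge n).

Lemma span_act n (S : pred nat) l m (f : dmap l m) (x : Delta n m) :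
  [forall k, S (x k)] -> [forall k, S ((act f x : Delta n l) k)].
Proof. by move/forallP=> Sx; apply/forallP=> k; rewrite /= ffunE. Qed.

(* Delta^S as a simplicial subset of Delta^n; vertices are named by natural
   numbers, those greater than n playing no role in S. *)
Definition span (n : nat) (S : pred nat) : ssub (Delta n) :=
  @SSub (Delta n) (fun m x => [forall k, S (x k)]) (@span_act n S).

(* The face opposite the vertex i, for i <= n. *)
Definition face (n i : nat) : ssub (Delta n) := span n (predC1 i).

(* The face of the unmarked simplex. *)
Definition bd (n i : nat) : esub (flat (Delta n)) :=
  @unmarked (flat (Delta n)) (face n i).

(* The face of the marked simplex: it contains the marked edge iff 0 < i < n. *)
Definition bd_e (n i : nat) : esub (Delta_e n) :=
  @induced (Delta_e n) (face n i).

Definition span_e (n : nat) (S : pred nat) : esub (Delta_e n) :=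
  @unmarked (Delta_e n) (span n S).

Definition horn_e (n i : nat) : esub (Delta_e n) :=
  bigsubU (fun j : 'I_n.+1 => j != i :> nat) (fun j : 'I_n.+1 => bd_e n j).

Definition mclass := forall X Y : esset, ehom X Y -> Prop.

Definition lifts (A B X Y : esset) (i : ehom A B) (p : ehom X Y) : Prop :=
  forall (u : ehom A X) (v : ehom B Y),
    ehom_eq (ecomp p u) (ecomp v i) ->
    exists h : ehom B X, ehom_eq (ecomp h i) u /\ ehom_eq (ecomp p h) v.

Definition rlp (I : mclass) : mclass := fun X Y p =>
  forall (A B : esset) (i : ehom A B), I A B i -> lifts i p.

Definition llp (J : mclass) : mclass := fun A B i =>
  forall (X Y : esset) (p : ehom X Y), J X Y p -> lifts i p.

Definition saturation (I : mclass) : mclass := llp (rlp I).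

Inductive eHorn : mclass :=
| eHorn_first n : 0 < n -> eHorn (incl (horn_e n 0))
| eHorn_last n : 0 < n -> eHorn (incl (horn_e n n)).

Inductive eHorn_and (C D : esset) (j : ehom C D) : mclass :=
| eHorn_and_horn A B (i : ehom A B) : eHorn i -> eHorn_and j i
| eHorn_and_extra : eHorn_and j j.

Definition I1 : mclass := eHorn_and (incl (subU (bd_e 4 1) (bd_e 4 3))).

Definition I2 : mclass :=
  eHorn_and (incl (subU (bd_e 4 2) (span_e 4 (mem [:: 1; 2; 3])))).

Definition I3 : mclass := eHorn_and (incl (subU (bd 3 1) (bd 3 3))).

Definition I4 : mclass := eHorn_and (incl (subU (bd 3 0) (bd 3 2))).

(* Main.v *)
Require Import Defs.
From mathcomp Require Import all_boot.

Set Implicit Arguments.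
Unset Strict Implicit.
Unset Printing Implicit Defensive.

(** By antitonicity of lifting, it is enough that a map with the right lifting
    property against I3 or I4 has it against the extra generators of I1 and
    I2. The latter are obtained inside Delta_e^4 (where the edge 04 is marked)
    by successively filling the faces
    - I1 from I3: 0123 by the extra generator, then 0134 and 01234 by outer
      horns at the vertex 0;
    - I2 from I3: 1234 by the extra generator, then 024, 0124, 0234 and 01234
      by outer horns at the vertex 4;
    - from I4: the mirror images under i |-> 4 - i.
    Every outer horn used contains the marked edge 04. *)

(** * Extending partial lifts from one subobject to a larger one *)

Section Extension.
Variables (X Y : esset) (p : ehom X Y) (D : esset).

(** The base map [v] is defined on all of [D], so consecutive extensions solve the same lifting
    problem and can be chained. Membership in [B] is produced together with the values, which spares
    carrying a separate inclusion of [A] in [B]. *)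
Definition extends (A B : esub D) : Prop :=
  forall (u : ehom (esset_of_sub A) X) (v : ehom D Y),
    ehom_eq (ecomp p u) (ecomp v (incl A)) ->
    exists u' : ehom (esset_of_sub B) X,
      [/\ ehom_eq (ecomp p u') (ecomp v (incl B)),
          forall n (x : esset_of_sub A n), exists xB : smem B (val x),
            u' n (exist _ (val x) xB) = u n x
        & forall e : marked (esset_of_sub A), exists eB : mmem B (val e),
            ehom_m u' (exist _ (val e) eB) = ehom_m u e].

Lemma extends_trans (A B C : esub D) :
  extends A B -> extends B C -> extends A C.
Proof.
move=> AB BC u v uv; have [u1 [uv1 s1 m1]] := AB u v uv.
have [u2 [uv2 s2 m2]] := BC u1 v uv1; exists u2; split=> //.
- move=> n x; have [xB <-] := s1 n x.
  by have [xC <-] := s2 n (exist _ (val x) xB); exists xC.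
- move=> e; have [eB <-] := m1 e.
  by have [eC <-] := m2 (exist _ (val e) eB); exists eC.
Qed.

(** Pointwise equal predicates still give different types of simplices, so [u] is transported along
    the membership proofs; [val_inj] makes the choice of these proofs irrelevant. *)
Lemma extends_ext (A B : esub D) :
  (forall n (x : D n), smem A x = smem B x) ->
  (forall e : marked D, mmem A e = mmem B e) -> extends A B.
Proof.
move=> sAB mAB u v [uvs uvm].
have sA n (x : esset_of_sub B n) : smem A (val x).
  by rewrite sAB; apply: valP.
have mA (e : marked (esset_of_sub B)) : mmem A (val e).
  by rewrite mAB; apply: valP.
pose us n (x : esset_of_sub B n) := u n (exist _ (val x) (sA n x)).
have usP m n (f : dmap m n) x : us m (act f x) = act f (us n x).
  by rewrite /us -shom_act; congr (u m _); apply: val_inj.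
pose um (e : marked (esset_of_sub B)) :=
  ehom_m u (exist _ (val e) (mA e)).
have umP e : us 1 (edge e) = edge (um e).
  by rewrite /us /um -ehom_edge; congr (u 1 _); apply: val_inj.
exists (@EHom (esset_of_sub B) X (SHom usP) um umP); split=> /=.
- by split=> [n x|e]; [apply: uvs | apply: uvm].
- move=> n x; have xB : smem B (val x) by rewrite -sAB; apply: valP.
  by exists xB; congr (u n _); apply: val_inj.
- move=> e; have eB : mmem B (val e) by rewrite -mAB; apply: valP.
  by exists eB; congr (ehom_m u _); apply: val_inj.
Qed.

Lemma lifts_extends (A B : esub D) :
  (forall n (x : D n), smem B x) -> (forall e : marked D, mmem B e) ->
  extends A B -> lifts (incl A) p.
Proof.
move=> sB mB AB u v uv; have [u1 [[pvs pvm] s1 m1]] := AB u v uv.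
pose us n (x : D n) := u1 n (exist _ x (sB n x)).
have usP m n (f : dmap m n) x : us m (act f x) = act f (us n x).
  by rewrite /us -shom_act; congr (u1 m _); apply: val_inj.
pose um (e : marked D) := ehom_m u1 (exist _ e (mB e)).
have umP e : us 1 (edge e) = edge (um e).
  by rewrite /us /um -ehom_edge; congr (u1 1 _); apply: val_inj.
exists (@EHom D X (SHom usP) um umP); split; split=> /=.
- move=> n x; have [xB <-] := s1 n x.
  by rewrite /us; congr (u1 n _); apply: val_inj.
- move=> e; have [eB <-] := m1 e.
  by rewrite /um; congr (ehom_m u1 _); apply: val_inj.
- by move=> n x; apply: pvs.
- by move=> e; apply: pvm.
Qed.

(* The square with sides H -> C and A -> B is a pushout: [g] is the partial
   inverse of the embedding [phi] and B = A u phi(C), where phi(C) brings no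
   new marked edge. *)
Lemma extends_pushout (C : esset) (phi : ehom C D) (H : esub C)
    (g : forall n, D n -> option (C n)) (A B : esub D) :
  (forall n, pcancel (@phi n) (@g n)) ->
  (forall n x c, g n x = Some c -> phi n c = x) ->
  (forall n (c : C n), smem H c = smem A (phi n c)) ->
  (forall e : marked C, mmem H e = mmem A (ehom_m phi e)) ->
  (forall n (x : D n), smem A x -> smem B x) ->
  (forall n (x : D n), smem B x -> smem A x || isSome (g n x)) ->
  (forall e : marked D, mmem A e = mmem B e) ->
  lifts (incl H) p -> extends A B.
Proof.
move=> phiK gP sH mH sAB sBA mAB lift_p u v [uvs uvm].
have sA n (c : esset_of_sub H n) : smem A (phi n (val c)).
  by rewrite -sH; apply: valP.
have mA (e : marked (esset_of_sub H)) : mmem A (ehom_m phi (val e)).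
  by rewrite -mH; apply: valP.
pose ws n (c : esset_of_sub H n) :=
  u n (exist _ (phi n (val c)) (sA n c)).
have wsP m n (f : dmap m n) c : ws m (act f c) = act f (ws n c).
  rewrite /ws -shom_act; congr (u m _); apply: val_inj.
  by rewrite /= shom_act.
pose wm (e : marked (esset_of_sub H)) :=
  ehom_m u (exist _ (ehom_m phi (val e)) (mA e)).
have wmP e : ws 1 (edge e) = edge (wm e).
  rewrite /ws /wm -ehom_edge; congr (u 1 _); apply: val_inj.
  by rewrite /= ehom_edge.
have [|h [[hws hwm] [phs phm]]] :=
    lift_p (@EHom (esset_of_sub H) X (SHom wsP) wm wmP) (ecomp v phi).
  split=> [n c|e] /=; first exact: uvs.
  exact: uvm.
(* The value carries both of its specifications. Membership in [A] is boolean and [g] computes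
   preimages, so the sigma type is inhabited without any choice principle. *)
have glue n (x : esset_of_sub B n) : {y : X n |
    (forall xA : smem A (val x), y = u n (exist _ (val x) xA)) /\
    (forall c, phi n c = val x -> y = h n c)}.
  case: (decP (@idP (smem A (val x)))) => xA.
    exists (u n (exist _ (val x) xA)); split=> [xA'|c cx].
      by congr (u n _); apply: val_inj.
    (* On the overlap, the simplex comes from [H], where [h] restricts to [u] composed with
       [phi]. *)
    have cH : smem H c by rewrite sH cx.
    have /= -> := hws n (exist _ c cH).
    by rewrite /ws; congr (u n _); apply: val_inj.
  have : isSome (g n (val x)).
    by have := sBA n (val x) (valP x); rewrite (negPf (introN idP xA)).
  case gx: (g n (val x)) => [c|//] _; exists (h n c); split=> [xA'|c' c'x].
    by case: xA.
  by move: gx; rewrite -c'x phiK => -[->].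
pose us n x := sval (glue n x).
have usA n (x : esset_of_sub B n) (xA : smem A (val x)) :
  us n x = u n (exist _ (val x) xA) by case: (svalP (glue n x)).
have usC n (x : esset_of_sub B n) c : phi n c = val x -> us n x = h n c.
  by case: (svalP (glue n x)) => _; apply.
have AorC n (x : esset_of_sub B n) :
    smem A (val x) \/ exists c, phi n c = val x.
  have /orP[xA|] := sBA n (val x) (valP x); first by left.
  by case gx: (g n (val x)) => [c|//] _; right; exists c; apply: gP.
have usP m n (f : dmap m n) x : us m (act f x) = act f (us n x).
  (* Naturality is checked on one side at a time, since [A] and the image of [phi] are both stable
     under the action. *)
  have [xA|[c cx]] := AorC n x.
    rewrite (usA n x xA) -shom_act.
    have fxA : smem A (val (act f x)) by apply: smem_act.
    by rewrite (usA m _ fxA); congr (u m _); apply: val_inj.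
  rewrite (usC n x c cx) (usC m _ (act f c)) ?shom_act //.
  by rewrite /= cx.
have mA' (e : marked (esset_of_sub B)) : mmem A (val e).
  by rewrite mAB; apply: valP.
pose um (e : marked (esset_of_sub B)) :=
  ehom_m u (exist _ (val e) (mA' e)).
have umP e : us 1 (edge e) = edge (um e).
  rewrite (usA 1 (edge e) (mmem_edge (mA' e))) /um -ehom_edge.
  by congr (u 1 _); apply: val_inj.
exists (@EHom (esset_of_sub B) X (SHom usP) um umP); split.
- split=> [n x|e] /=; last exact: uvm.
  have [xA|[c cx]] := AorC n x; first by rewrite (usA n x xA); apply: uvs.
  by rewrite (usC n x c cx); have /= -> := phs n c; rewrite cx.
- by move=> n [x xA]; exists (sAB n x xA); apply: usA.
- move=> e; have eB : mmem B (val e) by rewrite -mAB; apply: valP.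
  by exists eB => /=; congr (ehom_m u _); apply: val_inj.
Qed.

End Extension.

(** * Subcomplexes of a simplex described by vertex sets *)

Fixpoint subseqs (s : seq nat) : seq (seq nat) :=
  if s is i :: s' then map (cons i) (subseqs s') ++ subseqs s'
  else [:: [::]].

Lemma filter_subseqs (a : pred nat) s : filter a s \in subseqs s.
Proof.
elim: s => //= i s IHs; rewrite mem_cat; case: (a i); last by rewrite IHs orbT.
by rewrite map_f.
Qed.

Section Faces.
Variable n : nat.

Definition verts m (x : dmap m n) : seq nat :=
  [seq i <- iota 0 n.+1 | i \in codom (fun k => x k : nat)].

Lemma all_verts m (x : dmap m n) (S : pred nat) :
  all S (verts x) = [forall k, S (x k)].
Proof.
apply/allP/forallP=> [Sx k | Sx i].
  apply: Sx; rewrite mem_filter mem_iota /= add0n ltn_ord andbT.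
  by apply/codomP; exists k.
by rewrite mem_filter => /andP[/codomP[k ->] _].
Qed.

Lemma faces_act (L : seq (seq nat)) l m (f : dmap l m) (x : Delta n m) :
  has (fun s => [forall k, (x k : nat) \in s]) L ->
  has (fun s => [forall k, ((act f x : Delta n l) k : nat) \in s]) L.
Proof.
case/hasP=> s sL xs; apply/hasP; exists s => //.
exact: (@span_act n (fun i => i \in s)).
Qed.

Definition faces (L : seq (seq nat)) : esub (Delta_e n) :=
  @induced (Delta_e n) (@SSub (Delta n)
    (fun m x => has (fun s => [forall k, (x k : nat) \in s]) L)
    (@faces_act L)).

Lemma smem_faces L m (x : Delta n m) :
  smem (faces L) x = has (fun s => all (mem s) (verts x)) L.
Proof. by apply: eq_has => s; rewrite all_verts. Qed.

Lemma smem_horn i m (x : Delta n m) :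
  smem (horn_e n i) x =
  has (fun j => (j != i) && all (predC1 j) (verts x)) (iota 0 n.+1).
Proof.
apply/existsP/hasP=> [[j /andP[ji xj]] | [j]].
  exists (j : nat); first by rewrite mem_iota ltn_ord.
  by rewrite ji all_verts.
rewrite mem_iota /= add0n => jn /andP[ji xj]; exists (Ordinal jn).
by rewrite ji; move: xj; rewrite all_verts.
Qed.

Lemma long_edge0 : long_edge n ord0 = ord0.
Proof. by rewrite ffunE. Qed.

(** A vertex list is a subsequence of [iota 0 n.+1], so a comparison over simplices of all
    dimensions reduces to finitely many lists and is settled by computation. *)
Lemma eq_on_verts (P Q : pred (seq nat)) m (x : dmap m n) :
  all (fun T => P T == Q T) (subseqs (iota 0 n.+1)) ->
  P (verts x) = Q (verts x).
Proof. by move/allP/(_ (verts x))/(_ (filter_subseqs _ _))/eqP. Qed.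

End Faces.

(** * Face maps given by strictly increasing vertex lists *)

Section FaceMap.
Variables (n N : nat) (t : seq nat).
Hypotheses (t_size : size t = n.+1) (t_sorted : sorted ltn t).

Lemma face_map_exists :
  all (gtn N.+1) t -> exists d : dmap n N, forall i, d i = nth 0 t i :> nat.
Proof.
move=> /all_nthP tN.
have dE (i : 'I_n.+1) : (inord (nth 0 t i) : 'I_N.+1) = nth 0 t i :> nat.
  by rewrite inordK //; apply: tN; rewrite t_size.
have d_mono : [forall i : 'I_n.+1, forall j : 'I_n.+1, (i <= j) ==>
    ([ffun k : 'I_n.+1 => inord (nth 0 t k) : 'I_N.+1] i
     <= [ffun k : 'I_n.+1 => inord (nth 0 t k) : 'I_N.+1] j)].
  apply/forallP=> i; apply/forallP=> j; apply/implyP; rewrite !ffunE !dE.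
  rewrite leq_eqVlt => /orP[/eqP-> //|ij].
  by rewrite ltnW // (sorted_ltn_nth ltn_trans) ?inE ?t_size.
by exists (DMap d_mono) => i; rewrite ffunE dE.
Qed.

Variables (d : dmap n N) (dE : forall i, d i = nth 0 t i :> nat).

Lemma face_map_inj m : injective (dcomp d : dmap m n -> dmap m N).
Proof.
move=> a b ab; apply/val_inj/ffunP=> k; apply/val_inj.
have /(congr1 val) : dcomp d a k = dcomp d b k by rewrite ab.
rewrite !ffunE /= !dE => /eqP.
rewrite nth_uniq ?t_size // ?(sorted_uniq ltn_trans ltnn) //.
by move/eqP.
Qed.

(** The preimage sends [k] to the position of [x k] in [t]; this is monotone because [t] is strictly
    increasing. *)
Lemma face_map_lift m (x : dmap m N) :
  [forall k, (x k : nat) \in t] -> exists c, dcomp d c = x.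
Proof.
move=> /forallP xt.
have cE (k : 'I_m.+1) : (inord (index (x k : nat) t) : 'I_n.+1) =
    index (x k : nat) t :> nat by rewrite inordK // -t_size index_mem.
have c_mono : [forall i : 'I_m.+1, forall j : 'I_m.+1, (i <= j) ==>
    ([ffun k : 'I_m.+1 => inord (index (x k : nat) t) : 'I_n.+1] i
     <= [ffun k : 'I_m.+1 => inord (index (x k : nat) t) : 'I_n.+1] j)].
  apply/forallP=> i; apply/forallP=> j; apply/implyP; rewrite !ffunE !cE.
  move/(dmap_homo x); apply: contraTT; rewrite -!ltnNge.
  exact: (sorted_ltn_index ltn_trans).
exists (DMap c_mono); apply/val_inj/ffunP=> k; apply/val_inj.
by rewrite /= !ffunE dE cE nth_index.
Qed.

End FaceMap.

(** * Attaching a face to a subcomplex of the marked simplex *)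

Lemma all_verts_dcomp n N m (d : dmap n N) (c : dmap m n) (t s : seq nat) :
  (forall i, d i = nth 0 t i :> nat) ->
  all (mem s) (verts (dcomp d c)) = all (fun i => nth 0 t i \in s) (verts c).
Proof.
by move=> dE; rewrite !all_verts; apply: eq_forallb => k; rewrite ffunE /= dE.
Qed.

(* The face of Delta^N with vertex list [t] meets the subcomplex [faces L]
   exactly in the subcomplex of Delta^n of simplices whose vertex set
   satisfies [P]; moreover [faces L] contains the edge from 0 to N. *)
Definition attachable (n N : nat) (P : pred (seq nat)) (t : seq nat)
    (L : seq (seq nat)) : bool :=
  [&& size t == n.+1, sorted ltn t, all (gtn N.+1) t,
      has (fun s => (0 \in s) && (N \in s)) L &
      all (fun T => P T == has (fun s => all (fun i => nth 0 t i \in s) T) L)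
        (subseqs (iota 0 n.+1))].

Section Attach.
Variables (X Y : esset) (p : ehom X Y) (n N : nat).

(** Taking [M] to be [unit] or [void] treats marked horns and unmarked generators at once. The
    pushout is along the face map with vertex list [t]. *)
Lemma extends_face (M : Type) (e : M -> Delta n 1)
    (H : esub (ESSet e)) (P : pred (seq nat)) t L :
  attachable n N P t L ->
  (forall m (x : Delta n m), smem H x = P (verts x)) ->
  (forall a : M, mmem H a = smem H (e a)) ->
  (forall a (d : dmap n N), (forall i, d i = nth 0 t i :> nat) ->
    dcomp d (e a) = long_edge N) ->
  lifts (incl H) p -> extends p (faces N L) (faces N (t :: L)).
Proof.
case/and5P=> /eqP t_size t_sorted tN longL cond sH mH eN.
have [d dE] := face_map_exists t_size t_sorted tN.
have d_act k m (f : dmap k m) (x : Delta n m) :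
  dcomp d (act f x : Delta n k) = act f (dcomp d x : Delta N m).
  exact: dcompA.
pose phi_s : shom (Delta n) (Delta N) :=
  @SHom (Delta n) (Delta N) (fun m => dcomp d) d_act.
have phi_edge a : phi_s 1 (e a) = @edge (Delta_e N) tt by exact: eN.
pose phi : ehom (ESSet e) (Delta_e N) :=
  @EHom (ESSet e) (Delta_e N) phi_s (fun _ => tt) phi_edge.
have sHA m (c : Delta n m) :
    smem H c = smem (faces N L) (dcomp d c : Delta N m).
  rewrite sH smem_faces (eq_on_verts c cond).
  by apply: eq_has => s; rewrite (all_verts_dcomp c s dE).
(* The marked edge is already present, so attaching [t] creates no new one. *)
have long_mem : smem (faces N L) (long_edge N).
  have /hasP[s sL /andP[s0 sN]] := longL.
  apply/hasP; exists s => //; apply/forallP=> k.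
  by rewrite ffunE; case: ifP.
apply: (@extends_pushout _ _ _ _ _ phi H
  (fun m (x : Delta N m) => [pick c | dcomp d c == x])).
- move=> m c; case: pickP => [c' /eqP|/(_ c)]; last by rewrite eqxx.
  by move/(face_map_inj t_size t_sorted dE)->.
- by move=> m x c; case: pickP => // c' /eqP <- [->].
- exact: sHA.
- by move=> a; rewrite mH sHA eN.
- by move=> m x xL; apply/orP; right.
- move=> m x /orP[/(face_map_lift t_size t_sorted dE)[c cx]|xL].
    by apply/orP; right; case: pickP => [//|/(_ c)]; rewrite cx eqxx.
  by apply/orP; left.
- move=> a; transitivity true; first exact: long_mem.
  by apply/esym/orP; right; apply: long_mem.
Qed.

(** The condition on the ends of [t] makes the face map carry the marked edge of [Delta_e n] to that
    of [Delta_e N]. *)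
Lemma extends_horn i t L :
  lifts (incl (horn_e n i)) p -> (nth 0 t 0 == 0) && (nth 0 t n == N) ->
  attachable n N
    (fun T => has (fun j => (j != i) && all (predC1 j) T) (iota 0 n.+1)) t L ->
  extends p (faces N L) (faces N (t :: L)).
Proof.
move=> lift_p /andP[/eqP t0 /eqP tn] att.
apply: (@extends_face unit (fun _ => long_edge n) (horn_e n i) _ _ _ att) => //.
  by move=> m x; rewrite smem_horn.
move=> _ d dE; apply/val_inj/ffunP=> k; apply/val_inj; rewrite /= !ffunE dE.
by case: ifP; rewrite /= ?t0 ?tn.
Qed.

(** The generator has no marked edge, so [t] may avoid 0 or [N]. *)
Lemma extends_bdU i j t L :
  lifts (incl (subU (bd n i) (bd n j))) p ->
  attachable n N (fun T => all (predC1 i) T || all (predC1 j) T) t L ->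
  extends p (faces N L) (faces N (t :: L)).
Proof.
move=> lift_p att.
apply: (@extends_face void _ (subU (bd n i) (bd n j)) _ _ _ att) => //.
by move=> m x; rewrite !all_verts.
Qed.

Lemma lifts_faces (A : esub (Delta_e N)) (P : pred (seq nat)) L L' :
  (forall m (x : Delta N m), smem A x = P (verts x)) ->
  (forall e : unit, mmem A e = smem A (long_edge N)) ->
  all (fun T => P T == has (fun s => all (mem s) T) L)
    (subseqs (iota 0 N.+1)) ->
  iota 0 N.+1 \in L' ->
  extends p (faces N L) (faces N L') -> lifts (incl A) p.
Proof.
move=> sA mA cond fullL' ext.
have sAL m (x : Delta N m) : smem A x = smem (faces N L) x.
  by rewrite sA smem_faces (eq_on_verts x cond).
have sB m (x : Delta N m) : smem (faces N L') x.
  apply/hasP; exists (iota 0 N.+1) => //; apply/forallP=> k.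
  by rewrite mem_iota ltn_ord.
apply: (@lifts_extends _ _ _ _ A (faces N L') sB (fun e => sB 1 (long_edge N))).
apply: extends_trans ext; apply: extends_ext => //.
by move=> e; rewrite mA sAL.
Qed.

End Attach.

(** * Lifting against the four extra generators *)

Section Generators.
Variables (X Y : esset) (p : ehom X Y).

Lemma rlp_eHorn_and (C D : esset) (j : ehom C D) :
  rlp (eHorn_and j) p <-> rlp eHorn p /\ lifts j p.
Proof.
split=> [rlp_p | [rlp_h lift_j] A B i [A' B' i' | //]]; last exact: rlp_h.
by split=> [A B i hi|]; apply: rlp_p; constructor.
Qed.

Definition gen1 := incl (subU (bd_e 4 1) (bd_e 4 3)).
Definition gen2 := incl (subU (bd_e 4 2) (span_e 4 (mem [:: 1; 2; 3]))).
Definition gen3 := incl (subU (bd 3 1) (bd 3 3)).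
Definition gen4 := incl (subU (bd 3 0) (bd 3 2)).

Lemma lifts_gen1 L' :
  iota 0 5 \in L' ->
  extends p (faces 4 [:: [:: 0; 2; 3; 4]; [:: 0; 1; 2; 4]]) (faces 4 L') ->
  lifts gen1 p.
Proof.
apply: (lifts_faces (P := fun T => all (predC1 1) T || all (predC1 3) T)) => //.
by move=> m x; rewrite !all_verts.
Qed.

Lemma lifts_gen2 L' :
  iota 0 5 \in L' ->
  extends p (faces 4 [:: [:: 0; 1; 3; 4]; [:: 1; 2; 3]]) (faces 4 L') ->
  lifts gen2 p.
Proof.
apply: (lifts_faces
  (P := fun T => all (predC1 2) T || all (mem [:: 1; 2; 3]) T)) => //.
  by move=> m x; rewrite !all_verts.
(* [span_e] carries no mark, which is consistent with [faces] because the vertex 0 keeps the long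
   edge out of 123. *)
move=> e; congr (_ || _); apply/esym/forallP => /(_ ord0).
by rewrite long_edge0.
Qed.

Hypothesis rlp_h : rlp eHorn p.

Lemma extends_first_horn n N t L :
  (0 < n) && (nth 0 t 0 == 0) && (nth 0 t n == N) ->
  attachable n N
    (fun T => has (fun j => (j != 0) && all (predC1 j) T) (iota 0 n.+1)) t L ->
  extends p (faces N L) (faces N (t :: L)).
Proof.
case/andP=> /andP[n0 t0 tn]; apply: extends_horn; last by rewrite t0.
exact/rlp_h/eHorn_first.
Qed.

Lemma extends_last_horn n N t L :
  (0 < n) && (nth 0 t 0 == 0) && (nth 0 t n == N) ->
  attachable n N
    (fun T => has (fun j => (j != n) && all (predC1 j) T) (iota 0 n.+1)) t L ->
  extends p (faces N L) (faces N (t :: L)).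
Proof.
case/andP=> /andP[n0 t0 tn]; apply: extends_horn; last by rewrite t0.
exact/rlp_h/eHorn_last.
Qed.

Lemma gen1_of_gen3 : lifts gen3 p -> lifts gen1 p.
Proof.
(* [L'] stays open and is determined by the chain of extensions, hence the order of the goals. *)
move=> lift3; apply: lifts_gen1; last first.
  (* The faces 023 and 012 lie in 0234 and 0124. *)
  apply: extends_trans (extends_bdU (t := [:: 0; 1; 2; 3]) lift3 _) _ => //.
  apply: extends_trans
    (extends_first_horn (n := 3) (t := [:: 0; 1; 3; 4]) _ _) _ => //.
  (* Only the face 1234, opposite 0, is still missing. *)
  exact: (extends_first_horn (n := 4) (t := iota 0 5)).
exact: mem_head.
Qed.

Lemma gen1_of_gen4 : lifts gen4 p -> lifts gen1 p.
Proof.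
move=> lift4; apply: lifts_gen1; last first.
  (* The faces 234 and 124 lie in 0234 and 0124. *)
  apply: extends_trans (extends_bdU (t := [:: 1; 2; 3; 4]) lift4 _) _ => //.
  apply: extends_trans
    (extends_last_horn (n := 3) (t := [:: 0; 1; 3; 4]) _ _) _ => //.
  exact: (extends_last_horn (n := 4) (t := iota 0 5)).
exact: mem_head.
Qed.

Lemma gen2_of_gen3 : lifts gen3 p -> lifts gen2 p.
Proof.
move=> lift3; apply: lifts_gen2; last first.
  (* The face 134 lies in 0134, and 123 is the added triangle. *)
  apply: extends_trans (extends_bdU (t := [:: 1; 2; 3; 4]) lift3 _) _ => //.
  (* The triangle 024, filled from 04 and 24, is a common face of 0124 and 0234 and completes the
     horn in each. *)
  apply: extends_trans
    (extends_last_horn (n := 2) (t := [:: 0; 2; 4]) _ _) _ => //.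
  apply: extends_trans
    (extends_last_horn (n := 3) (t := [:: 0; 1; 2; 4]) _ _) _ => //.
  apply: extends_trans
    (extends_last_horn (n := 3) (t := [:: 0; 2; 3; 4]) _ _) _ => //.
  exact: (extends_last_horn (n := 4) (t := iota 0 5)).
exact: mem_head.
Qed.

Lemma gen2_of_gen4 : lifts gen4 p -> lifts gen2 p.
Proof.
move=> lift4; apply: lifts_gen2; last first.
  (* Here 123 is the added triangle and 013 lies in 0134. *)
  apply: extends_trans (extends_bdU (t := [:: 0; 1; 2; 3]) lift4 _) _ => //.
  apply: extends_trans
    (extends_first_horn (n := 2) (t := [:: 0; 2; 4]) _ _) _ => //.
  apply: extends_trans
    (extends_first_horn (n := 3) (t := [:: 0; 1; 2; 4]) _ _) _ => //.
  apply: extends_trans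
    (extends_first_horn (n := 3) (t := [:: 0; 2; 3; 4]) _ _) _ => //.
  exact: (extends_first_horn (n := 4) (t := iota 0 5)).
exact: mem_head.
Qed.

End Generators.

Lemma saturationS (I J : mclass) (X Y : esset) (f : ehom X Y) :
  (forall (X' Y' : esset) (p : ehom X' Y'), rlp J p -> rlp I p) ->
  saturation I f -> saturation J f.
Proof. by move=> JI If X' Y' p /JI; apply: If. Qed.

Theorem lemma6p5 (X Y : esset) (f : ehom X Y) :
  saturation I1 f \/ saturation I2 f -> saturation I3 f /\ saturation I4 f.
Proof.
case=> If; split; apply: saturationS If => X' Y' p /rlp_eHorn_and[h g];
  apply/rlp_eHorn_and; split=> //.
- exact: gen1_of_gen3.
- exact: gen1_of_gen4.
- exact: gen2_of_gen3.
- exact: gen2_of_gen4.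
Qed.
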